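(* Consider a nontrivial cycle of $C$ with $K$ odd elements and $L$ even elements. Then $\delta<\frac{K+L}{K}<\delta+\frac{1}{3\log(2)}\cdot\frac34\cdot\frac{1}{X_0}.$
   Context: $C(n)=n/2$ for even $n$, $C(n)=(3n+1)/2$ for odd $n$ (on positive integers). A nontrivial cycle is a set $\{n,C(n),\dots,C^{p-1}(n)\}$ with $C^p(n)=n$, different from $\{1,2\}$. $\delta:=\frac{\log 3}{\log 2}$. $X_0$ is a positive integer with $X_0>765$ such that for every positive integer $n\leq X_0$ the sequence $n,C(n),C^2(n),\dots$ eventually reaches $1$. *)

(* Defs.v *)
From mathcomp Require Import all_boot all_order all_algebra.
From mathcomp Require Import finmap.
From mathcomp Require Import reals exp.

Set Implicit Arguments.
Unset Strict Implicit.
Unset Printing Implicit Defensive.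

Import Order.TTheory GRing.Theory Num.Theory.

(* Positive integers are the nats [n] with [0 < n]; this map preserves them,
   and its extra fixed point 0 is excluded wherever positivity matters. *)
Definition collatz (n : nat) : nat :=
  if odd n then ((3 * n + 1)./2)%N else n./2.

Definition reaches_one (n : nat) : Prop :=
  exists k : nat, iter k collatz n = 1%N.

(* [p] need not be the minimal period. Since [A] is a finite set, repeated
   entries of [traject collatz n p] are counted only once in cardinals. *)
Definition is_cycle (A : {fset nat}) : Prop :=
  exists n p : nat,
    [/\ (0 < n)%N, (0 < p)%N, iter p collatz n = n
      & A = [fset x in traject collatz n p]%fset].

Definition nontrivial_cycle (A : {fset nat}) : Prop :=
  is_cycle A /\ A <> [fset 1%N; 2%N]%fset.

Definition num_odd (A : {fset nat}) : nat := #|` [fset x in A | odd x]%fset |.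

Definition num_even (A : {fset nat}) : nat :=
  #|` [fset x in A | ~~ odd x]%fset |.

Definition delta (R : realType) : R := (ln 3 / ln 2)%R.

(* Main.v *)
(* Multiplying [2 C(a) = 3 a + 1] (odd [a]) and [2 C(a) = a] (even [a]) over the
   cycle gives [2 ^ (K + L) = \prod_(a odd) (3 + 1 / a)].  Bounding each logarithm
   by [ln 3 < ln (3 + 1 / a) < ln 3 + 1 / (3 a)] reduces the theorem to the claim
   that [1 / a] has mean at most [3 / (4 X0)] over the odd elements, all of which
   exceed [X0].  For the claim, every element of the cycle starts a block of at
   most 8 consecutive iterates on which [1 / a - 3 / (4 X0)], summed over the odd
   iterates, is nonpositive. *)

Require Import Defs.
From mathcomp Require Import all_boot all_order all_algebra.
From mathcomp Require Import finmap.
From mathcomp Require Import reals exp.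
From mathcomp Require Import zify ring lra.

Set Implicit Arguments.
Unset Strict Implicit.
Unset Printing Implicit Defensive.

Import Order.TTheory GRing.Theory Num.Theory.
Local Open Scope ring_scope.

(** * Iterates and cycles of the Collatz map *)

Lemma collatz_step (n : nat) :
  odd n /\ (2 * collatz n = 3 * n + 1)%N \/ ~~ odd n /\ (2 * collatz n = n)%N.
Proof. by rewrite /collatz; case: ifP => On; [left | right]; lia. Qed.

Lemma collatz_gt0 (n : nat) : (0 < n)%N -> (0 < collatz n)%N.
Proof. by have := collatz_step n; lia. Qed.

Lemma iter_collatz_gt0 (k n : nat) : (0 < n)%N -> (0 < iter k collatz n)%N.
Proof. by move=> n_gt0; elim: k => //= k; apply: collatz_gt0. Qed.

Lemma iter_collatz1 (k : nat) : iter k collatz 1 = 1%N \/ iter k collatz 1 = 2%N.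
Proof. by elim: k => [|k [] /= ->]; [left | right | left]. Qed.

Lemma iter_mul_period (T : Type) (f : T -> T) (p k : nat) (x : T) :
  iter p f x = x -> iter (k * p) f x = x.
Proof. by move=> fx; elim: k => // k IHk; rewrite mulSn iterD IHk. Qed.

Lemma cycle_gt0 (A : {fset nat}) (a : nat) : is_cycle A -> a \in A -> (0 < a)%N.
Proof.
move=> [n [p [n_gt0 _ _ ->]]]; rewrite in_fset => /trajectP[i _ ->].
exact: iter_collatz_gt0.
Qed.

Lemma cycle_neq0 (A : {fset nat}) : is_cycle A -> exists a, a \in A.
Proof.
move=> [n [p [_ p_gt0 _ ->]]]; exists n; rewrite in_fset.
by apply/trajectP; exists 0%N.
Qed.

Lemma cycle_iter (A : {fset nat}) (a k : nat) :
  is_cycle A -> a \in A -> iter k collatz a \in A.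
Proof.
move=> [n [p [_ p_gt0 Cn ->]]]; rewrite !in_fset => /trajectP[i _ ->].
apply/trajectP; exists ((k + i) %% p)%N; first by rewrite ltn_mod.
by rewrite -iterD {1}(divn_eq (k + i) p) addnC iterD iter_mul_period.
Qed.

Lemma cycle_transitive (A : {fset nat}) (a b : nat) :
  is_cycle A -> a \in A -> b \in A -> exists2 k, (0 < k)%N & iter k collatz a = b.
Proof.
move=> [n [p [_ p_gt0 Cn ->]]]; rewrite !in_fset.
move=> /trajectP[i ip ->] /trajectP[j _ ->].
(* Close the turn back to [n] before walking to position [j]: this keeps the exponent positive even
   for [a = b], which later yields preimages inside the cycle. *)
exists (j + (p - i))%N; first by rewrite addn_gt0 subn_gt0 ip orbT.
by rewrite -iterD -addnA subnK ?(ltnW ip)// iterD Cn.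
Qed.

(** Every element is a positive iterate of itself, so [collatz] maps the finite set [A] onto itself
    and is therefore injective on it. *)
Lemma perm_cycle (A : {fset nat}) :
  is_cycle A -> perm_eq [seq collatz a | a <- A] A.
Proof.
move=> cA; have sub : {subset A <= [seq collatz a | a <- A]}.
  move=> a aA; have [[//|k] _ Ca] := cycle_transitive cA aA aA.
  by rewrite -Ca iterS; apply/map_f/cycle_iter.
apply: uniq_perm => [||a]; rewrite ?fset_uniq//.
  by apply: leq_size_uniq (fset_uniq A) sub _; rewrite size_map.
apply/idP/idP => [/mapP[b bA ->]|/sub//].
exact: (cycle_iter 1 cA).
Qed.

(** An element at most [X] would bring 1 into the cycle, whose elements would then all be iterates
    of 1, that is, 1 or 2. *)
Lemma nontrivial_cycle_gt (X : nat) (A : {fset nat}) (a : nat) :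
    (forall n : nat, (0 < n)%N -> (n <= X)%N -> reaches_one n) ->
  nontrivial_cycle A -> a \in A -> (X < a)%N.
Proof.
move=> verified [cA neqA] aA; rewrite ltnNge; apply/negP => leaX; apply: neqA.
have [k Ca] := verified a (cycle_gt0 cA aA) leaX.
have oneA : 1%N \in A by rewrite -Ca; apply: cycle_iter.
apply/fsetP => b; rewrite in_fset2; apply/idP/orP => [bA|[]/eqP->//].
  have [j _ <-] := cycle_transitive cA oneA bA.
  by have [->|->] := iter_collatz1 j; [left | right].
exact: (cycle_iter 1 cA oneA).
Qed.

(** * Sums over the elements of a cycle *)

Lemma sum_cycle (V : nmodType) (A : {fset nat}) (f : nat -> V) :
  is_cycle A -> \sum_(a <- A) f (collatz a) = \sum_(a <- A) f a.
Proof.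
by move=> cA; rewrite -(big_map collatz predT f); apply/perm_big/perm_cycle.
Qed.

Lemma card_fset_sub (A : {fset nat}) (P : pred nat) :
  #|` [fset x in A | P x]%fset| = count P A.
Proof.
rewrite -size_filter; apply: perm_size; apply: uniq_perm => [||x].
- exact: fset_uniq.
- by rewrite filter_uniq ?fset_uniq.
- by rewrite mem_filter !inE andbC.
Qed.

Lemma sumr_const_seq (V : nmodType) (I : Type) (r : seq I) (x : V) :
  \sum_(i <- r) x = x *+ size r.
Proof. by rewrite big_const_seq count_predT iter_addr_0. Qed.

(** * Mean reciprocal of the odd elements *)

Definition excess (R : realType) (X n : nat) : R :=
  if odd n then n%:R^-1 - 3 / 4 * X%:R^-1 else 0.

(** Turns division-free integer comparisons, within reach of [lia], into bounds on reciprocals that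
    are linear for [lra]. *)
Lemma invr_le_scale (R : realFieldType) (p q m n : nat) :
    (0 < n)%N -> (0 < p)%N -> (p * n <= q * m)%N ->
  (m%:R^-1 : R) <= q%:R / p%:R * n%:R^-1.
Proof.
move=> n_gt0 p_gt0 le_nm.
have m_gt0 : (0 < m)%N by move: le_nm; case: m; nia.
rewrite -mulrA -invfM ler_pdivlMr ?mulr_gt0 ?ltr0n// mulrC ler_pdivrMr ?ltr0n//.
by rewrite -!natrM ler_nat.
Qed.

(* Only an odd [n < 4 X / 3] has positive excess.  Since [n / 2 > X] for even
   [n], the iterates of such an [n] are odd as long as they stay below [2 X + 2];
   each parity branching at a larger iterate is followed until the excess is
   compensated, the longest block being odd, odd, even, odd, odd, even, odd, odd.
   The bound 64 absorbs the "+1" terms in the last iterate. *)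
Lemma excess_block (R : realType) (X n : nat) : (64 <= X)%N ->
    (forall i, (X < iter i collatz n)%N) ->
  exists2 b, (0 < b <= 8)%N & \sum_(0 <= i < b) excess R X (iter i collatz n) <= 0.
Proof.
move=> X_ge64 gtX; have X_gt0 : (0 < X)%N by apply: leq_trans X_ge64.
pose m i := iter i collatz n.
have st i : odd (m i) /\ (2 * m i.+1 = 3 * m i + 1)%N \/
            ~~ odd (m i) /\ (2 * m i.+1 = m i)%N by exact: collatz_step.
have gt i : (X < m i)%N by exact: gtX.
have yz : (n%:R^-1 : R) <= X%:R^-1.
  have := invr_le_scale R (p := 1) (q := 1) (m := n) X_gt0 isT.
  by rewrite divr1 mul1r; apply; have := gt 0%N; rewrite /m /=; lia.
have n_gt0 : (0 < n)%N by have := gt 0%N; rewrite /m /=; lia.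
have y_gt0 : 0 < (n%:R^-1 : R) by rewrite invr_gt0 ltr0n.
have sE b : \sum_(0 <= i < b.+1) excess R X (iter i collatz n) =
    \sum_(0 <= i < b) excess R X (iter i collatz n) + excess R X (m b).
  by rewrite big_nat_recr.
have s0 : \sum_(0 <= i < 0) excess R X (iter i collatz n) = 0 by rewrite big_geq.
have eo i : odd (m i) -> excess R X (m i) = (m i)%:R^-1 - 3 / 4 * X%:R^-1.
  by rewrite /excess => ->.
have ee i : ~~ odd (m i) -> excess R X (m i) = 0 by rewrite /excess => /negbTE->.
have yle p q i := @invr_le_scale R p q (m i) n n_gt0.
have y0 : m 0%N = n by [].
clearbody m.
have [lt0|ge0] := ltnP (3 * n) (4 * X); last first.
  exists 1%N; rewrite // sE s0.
  have y_le : (n%:R^-1 : R) <= 3 / 4 * X%:R^-1 by apply: invr_le_scale.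
  by case: (boolP (odd (m 0%N))) => [/eo|/ee] ->; rewrite ?y0; lra.
have o0 : odd (m 0%N) by move: (st 0%N) (gt 1%N); lia.
have o1 : odd (m 1%N) by move: (st 0%N) (st 1%N) (gt 2%N); lia.
have /yle y1 : (3 * n <= 2 * m 1%N)%N by have := st 0%N; lia.
(* Two odd iterates: 1/n + 2/(3n) = 5/(3n) is at most 3/(2X) exactly when 9n >= 10X. *)
have [lt1|ge1] := ltnP (9 * n) (10 * X); last first.
  exists 2%N; rewrite // !sE s0 !eo// y0.
  have y_le : (n%:R^-1 : R) <= 9 / 10 * X%:R^-1 by apply: invr_le_scale.
  by have := y1 isT; lra.
have [o2|e2] := boolP (odd (m 2%N)).
  exists 3%N; rewrite // !sE s0 !eo// y0.
  have /yle : (9 * n <= 4 * m 2%N)%N by move: (st 0%N) (st 1%N); lia.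
  by move=> /(_ isT) y2; have := y1 isT; lra.
(* The even [m 2] brings the orbit down to about 9n/8 < 5X/4, so two further odd iterates are
   forced. *)
have o3 : odd (m 3%N)
  by move: (st 0%N) (st 1%N) (st 2%N) (st 3%N) (gt 4%N); lia.
have o4 : odd (m 4%N)
  by move: (st 0%N) (st 1%N) (st 2%N) (st 3%N) (st 4%N) (gt 5%N); lia.
have /yle y3 : (9 * n <= 8 * m 3%N)%N
  by move: (st 0%N) (st 1%N) (st 2%N); lia.
have /yle y4 : (27 * n <= 16 * m 4%N)%N
  by move: (st 0%N) (st 1%N) (st 2%N) (st 3%N); lia.
(* Four odd iterates: the reciprocals total at most 85/(27n), to be compared with 3/X. *)
have [lt4|ge4] := ltnP (81 * n) (85 * X); last first.
  exists 5%N; rewrite // !sE s0 (ee 2%N)// !eo// y0.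
  have y_le : (n%:R^-1 : R) <= 81 / 85 * X%:R^-1 by apply: invr_le_scale.
  by move: (y1 isT) (y3 isT) (y4 isT); lra.
have [o5|e5] := boolP (odd (m 5%N)).
  exists 6%N; rewrite // !sE s0 (ee 2%N)// !eo// y0.
  have /yle : (81 * n <= 32 * m 5%N)%N
    by move: (st 0%N) (st 1%N) (st 2%N) (st 3%N) (st 4%N); lia.
  by move=> /(_ isT) y5; move: (y1 isT) (y3 isT) (y4 isT); lra.
(* As 81n < 85X, this exact value keeps [m 6] and [m 7] below 2(X + 1), so halving either would not
   stay above [X]. *)
have e6 : (128 * m 6%N = 162 * n + 170)%N.
  by move: (st 0%N) (st 1%N) (st 2%N) (st 3%N) (st 4%N) (st 5%N); lia.
have o6 : odd (m 6%N) by move: (st 6%N) (gt 7%N); lia.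
have o7 : odd (m 7%N) by move: (st 6%N) (st 7%N) (gt 8%N); lia.
have /yle y6 : (81 * n <= 64 * m 6%N)%N by lia.
have /yle y7 : (243 * n <= 128 * m 7%N)%N by have := st 6%N; lia.
(* Six odd iterates: the reciprocals total at most 1085/(243n) < 9/(2X). *)
exists 8%N; rewrite // !sE s0 (ee 2%N)// (ee 5%N)// !eo// y0.
by move: (y1 isT) (y3 isT) (y4 isT) (y6 isT) (y7 isT); lra.
Qed.

Lemma excess_le1 (R : realType) (X n : nat) : excess R X n <= 1.
Proof.
rewrite /excess; case: ifP => // On.
have n_gt0 : (0 < n)%N by case: n On.
have : (n%:R^-1 : R) <= 1 by rewrite invf_le1 ?ltr0n// ler1n.
have : 0 <= (X%:R^-1 : R) by rewrite invr_ge0.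
lra.
Qed.

(* Cut the trajectory into blocks of nonpositive excess: only the last,
   incomplete one, of length less than 8, contributes. *)
Lemma sum_excess_iter_le8 (R : realType) (X N n : nat) : (64 <= X)%N ->
    (forall i, (X < iter i collatz n)%N) ->
  \sum_(0 <= i < N) excess R X (iter i collatz n) <= 8.
Proof.
move=> X_ge64; elim/ltn_ind: N n => N IHN n gtX.
have [ltN|geN] := ltnP N 8.
  apply: le_trans (_ : \sum_(0 <= i < N) 1 <= 8).
    by apply: ler_sum => i _; apply: excess_le1.
  by rewrite sumr_const_nat subn0 ler_nat ltnW.
have [b /andP[b_gt0 leb8] sum_le0] := excess_block R X_ge64 gtX.
have lebN : (b <= N)%N by apply: leq_trans geN.
rewrite (big_cat_nat (n := b))//= -[leRHS]add0r lerD//.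
rewrite -{1}[b]add0n big_addn.
under eq_bigr do rewrite iterD.
by apply: IHN => [|i]; [lia | rewrite -iterD].
Qed.

(* Blocks need not fit the period of the cycle; but the excess over [N] turns
   is bounded independently of [N], so the excess over one turn is at most 0. *)
Lemma sum_excess_cycle_le0 (R : realType) (X : nat) (A : {fset nat}) :
    (64 <= X)%N -> is_cycle A -> (forall a, a \in A -> (X < a)%N) ->
  \sum_(a <- A) excess R X a <= 0.
Proof.
move=> X_ge64 cA gtX; set S := \sum_(a <- A) _.
have sum_iter i : \sum_(a <- A) excess R X (iter i collatz a) = S.
  elim: i => // i <-; rewrite -(sum_cycle (fun a => excess R X (iter i collatz a)))//.
  by apply: eq_bigr => a _; rewrite -iterSr.
(* Starting from all elements at once makes each time step contribute exactly [S], for every [N]. *)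
have leS N : N%:R * S <= 8 * (size A)%:R.
  have -> : N%:R * S = \sum_(a <- A) \sum_(0 <= i < N) excess R X (iter i collatz a).
    rewrite exchange_big /=; under eq_bigr do rewrite sum_iter.
    by rewrite sumr_const_nat subn0 mulr_natl.
  rewrite mulr_natr -sumr_const_seq big_seq [leRHS]big_seq.
  apply: ler_sum => a aA; apply: sum_excess_iter_le8 => // i.
  exact/gtX/cycle_iter.
rewrite leNgt; apply/negP => S_gt0.
have := archi_boundP (divr_ge0 (mulr_ge0 (ler0n R 8) (ler0n R (size A))) (ltW S_gt0)).
by rewrite ltr_pdivrMr// ltNge leS.
Qed.

(** * Logarithms over the cycle and the two bounds *)

Lemma ln_1Dx_lt (R : realType) (x : R) : 0 < x -> ln (1 + x) < x.
Proof.
move=> x_gt0; rewrite -[ltRHS]expRK ltr_ln ?posrE ?expR_gt0 ?addr_gt0//.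
by rewrite expR_gt1Dx// gt_eqF.
Qed.

(** For odd [a], 2 C(a) = a (3 + 1/a). After taking logarithms, the sums of ln C(a) and ln a cancel
    because [collatz] permutes the cycle. *)
Lemma sum_ln_cycle (R : realType) (A : {fset nat}) : is_cycle A ->
  (size A)%:R * ln 2 = \sum_(a <- A | odd a) ln (3 + a%:R^-1) :> R.
Proof.
move=> cA; have : \sum_(a <- A) ln (collatz a)%:R =
    \sum_(a <- A) (ln a%:R - ln 2 + if odd a then ln (3 + a%:R^-1) else 0) :> R.
  rewrite !big_seq; apply: eq_bigr => a /(cycle_gt0 cA) a_gt0.
  have Ca_gt0 := collatz_gt0 a_gt0.
  have posn k : (0 < k)%N -> k%:R \is @Num.pos R by rewrite posrE ltr0n.
  have ln2C : ln (2 * (collatz a)%:R) = ln 2 + ln (collatz a)%:R :> R.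
    by rewrite lnM ?posn.
  have pos3 : 3 + a%:R^-1 \is @Num.pos R.
    by rewrite posrE addr_gt0 ?invr_gt0 ?ltr0n.
  have [[-> Ca]|[/negbTE-> Ca]] := collatz_step a.
    apply: (addrI (ln 2)); rewrite -ln2C -natrM Ca addrA addrCA subrr addr0.
    rewrite -lnM ?posn// mulrDr divff ?pnatr_eq0 -?lt0n//.
    by rewrite natrD natrM [_ * 3]mulrC.
  apply: (addrI (ln 2)); rewrite -ln2C -natrM Ca; ring.
rewrite (sum_cycle (fun a => ln a%:R))// big_split /= sumrB -big_mkcond /=.
rewrite sumr_const_seq -mulr_natl; lra.
Qed.

Theorem theorem27 (R : realType) (X0 : nat) (X0_gt765 : (765 < X0)%N)
    (X0_verified : forall n : nat, (0 < n)%N -> (n <= X0)%N -> reaches_one n)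
    (A : {fset nat}) (A_cycle : nontrivial_cycle A)
    (K L : nat) (K_odd : K = num_odd A) (L_even : L = num_even A) :
  delta R < (K%:R + L%:R) / K%:R /\
  (K%:R + L%:R) / K%:R
    < delta R + 1 / (3 * ln 2) * (3 / 4) * (1 / X0%:R).
Proof.
have [cA _] := A_cycle.
have X0_gt0 : (0 < X0)%N by apply: leq_trans X0_gt765.
have sizeA : (size A = K + L)%N.
  rewrite K_odd L_even /num_odd /num_even !card_fset_sub.
  exact/esym/count_predC.
have prodE := sum_ln_cycle R cA.
have countK (x : R) : \sum_(a <- A | odd a) x = K%:R * x.
  by rewrite big_const_seq iter_addr_0 K_odd /num_odd card_fset_sub mulr_natl.
have ln2_gt0 : 0 < ln 2 :> R by rewrite ln_gt0// ltr1n.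
have size_gt0 : (0 < size A)%N.
  by have [a aA] := cycle_neq0 cA; rewrite cardfs_gt0; apply/fset0Pn; exists a.
(* Without odd elements the logarithmic identity would read (K + L) ln 2 = 0. *)
have has_odd : has odd A.
  apply: contraLR size_gt0; rewrite -leqNgt leqn0 => /hasPn noodd.
  move: prodE; rewrite big_seq_cond big_pred0 => [|a].
    by move/eqP; rewrite mulf_eq0 (gt_eqF ln2_gt0) orbF pnatr_eq0.
  by apply/negP => /andP[/noodd/negP].
have K_gt0 : 0 < K%:R :> R.
  by rewrite ltr0n K_odd /num_odd card_fset_sub -has_count.
have odd_inv_gt0 a : odd a -> 0 < a%:R^-1 :> R.
  by move=> Oa; rewrite invr_gt0 ltr0n; case: a Oa.
have lower : K%:R * ln 3 < (size A)%:R * ln 2 :> R.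
  rewrite prodE -countK; apply: ltr_sum => // a /odd_inv_gt0 a_gt0.
  by rewrite ltr_ln ?posrE ?addr_gt0 ?ltrDl.
have upper : (size A)%:R * ln 2 < K%:R * (ln 3 + 3^-1 * (3 / 4 * X0%:R^-1)) :> R.
  apply: lt_le_trans
    (_ : \sum_(a <- A | odd a) (ln 3 + 3^-1 * a%:R^-1) <= _).
    rewrite prodE; apply: ltr_sum => // a /odd_inv_gt0 a_gt0.
    have -> : 3 + a%:R^-1 = 3 * (1 + 3^-1 * a%:R^-1) :> R.
      by rewrite mulrDr mulr1 mulVKf ?pnatr_eq0.
    have pos : 0 < 3^-1 * a%:R^-1 :> R by rewrite mulr_gt0// invr_gt0 ltr0n.
    by rewrite lnM ?posrE ?addr_gt0// ltrD2l ln_1Dx_lt.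
  have gtX a : a \in A -> (X0 < a)%N.
    exact: nontrivial_cycle_gt X0_verified A_cycle.
  (* Nonpositive total excess bounds the sum of 1/a over odd [a] by 3K/(4 X0). *)
  have := sum_excess_cycle_le0 R (leq_trans _ X0_gt765) cA gtX.
  rewrite /excess -big_mkcond sumrB countK big_split /= countK -mulr_sumr.
  by move=> /(_ isT); lra.
rewrite -natrD -sizeA /delta; split.
  by rewrite ltr_pdivlMr// mulrAC ltr_pdivrMr// mulrC.
rewrite ltr_pdivrMr//.
rewrite -(ltr_pM2r ln2_gt0); apply: lt_le_trans upper _.
rewrite le_eqVlt; apply/orP; left; apply/eqP; field.
by rewrite !gt_eqF ?ltr0n.
Qed.
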